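(* There is $n_0$ such that for all $n\ge n_0$ and every integer $b \geq 200\, n\ln n$ the following holds: in the monotone $(1:b)$ Avoider-Enforcer game on $E(K_n)$, and also in the strict $(1:b)$ Avoider-Enforcer game on $E(K_n)$, Avoider has a strategy ensuring that at the end of the game Avoider's graph is a forest plus at most one additional edge, i.e.\ it can be obtained from a forest on the vertex set of $K_n$ by adding at most one edge.
   Context: Avoider-Enforcer games on $E(K_n)$: two players, Avoider (who moves first) and Enforcer, alternately claim previously unclaimed edges of the complete graph $K_n$ until all edges are claimed; Avoider's graph is the graph on $V(K_n)$ formed by the edges he claimed. In the strict $(1:b)$ game, in each turn Avoider claims exactly $1$ unclaimed edge and Enforcer claims exactly $b$ unclaimed edges; if fewer than $b$ unclaimed edges remain at Enforcer's turn, he claims all of them. In the monotone $(1:b)$ game, in each turn Avoider claims at least $1$ and Enforcer at least $b$ unclaimed edges (again, if fewer than $b$ remain at Enforcer's turn, he claims all of them). $\ln$ denotes the natural logarithm. *)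

(* Defs.v *)
From mathcomp Require Import all_boot.

Set Implicit Arguments.
Unset Strict Implicit.
Unset Printing Implicit Defensive.

(** A graph on the vertex set ['I_n] is given by its set of edges, a subset of
    [Kn n], the set of all two-element sets of vertices. *)

Definition Kn (n : nat) : {set {set 'I_n}} := [set e : {set 'I_n} | #|e| == 2].

Definition adj (n : nat) (F : {set {set 'I_n}}) : rel 'I_n :=
  fun x y => [set x; y] \in F.

(** When [F \subset Kn n], the [ucycle]s with at most two vertices are the empty
    sequence and single edges traversed back and forth, neither of which is a
    cycle of the graph. *)
Definition forest (n : nat) (F : {set {set 'I_n}}) : Prop :=
  F \subset Kn n /\ forall c : seq 'I_n, ucycle (adj F) c -> size c <= 2.

Definition forest_plus_at_most_one_edge (n : nat) (A : {set {set 'I_n}}) : Prop :=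
  exists F D : {set {set 'I_n}},
    [/\ forest F, D \subset Kn n, #|D| <= 1 & A = F :|: D].

Variant rule := Strict | Monotone.

(** The player whose bias is [k] claims the set [M] when [U] is the set of
    unclaimed edges. The [minn] says that a player claims all of [U] when it
    has fewer than [k] elements; it is inactive for Avoider, who has bias 1 and
    only moves when [U] is nonempty. *)
Definition legal_move (n : nat) (r : rule) (k : nat) (U M : {set {set 'I_n}}) : bool :=
  (M \subset U) &&
  match r with
  | Strict => #|M| == minn k #|U|
  | Monotone => minn k #|U| <= #|M|
  end.

(** A history lists the completed rounds in chronological order, each one as
    the edges claimed by Avoider followed by those claimed by Enforcer. *)
Definition history (n : nat) := seq ({set {set 'I_n}} * {set {set 'I_n}}).

Definition avoider_graph (n : nat) (h : history n) : {set {set 'I_n}} :=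
  \bigcup_(m <- h) m.1.

Definition enforcer_graph (n : nat) (h : history n) : {set {set 'I_n}} :=
  \bigcup_(m <- h) m.2.

Definition unclaimed (n : nat) (h : history n) : {set {set 'I_n}} :=
  Kn n :\: (avoider_graph h :|: enforcer_graph h).

Definition strategy (n : nat) := history n -> {set {set 'I_n}}.

(** Histories of the [(1 : b)] game that can arise when Avoider follows [s] and
    Enforcer makes arbitrary legal moves. If Avoider claims the last edges,
    Enforcer's only legal move is [set0]. *)
Inductive play (n b : nat) (r : rule) (s : strategy n) : history n -> Prop :=
| play_start : play b r s [::]
| play_round (h : history n) (M : {set {set 'I_n}}) :
    play b r s h -> unclaimed h != set0 ->
    legal_move r b (unclaimed h :\: s h) M ->
    play b r s (rcons h (s h, M)).

Definition legal_strategy (n b : nat) (r : rule) (s : strategy n) : Prop :=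
  forall h : history n, play b r s h -> unclaimed h != set0 ->
    legal_move r 1 (unclaimed h) (s h).

(** The game is over once [unclaimed h = set0]; it always gets there, because
    a legal move of Avoider claims at least one edge. *)
Definition avoider_can_ensure (n b : nat) (r : rule)
    (P : {set {set 'I_n}} -> Prop) : Prop :=
  exists2 s : strategy n, legal_strategy b r s &
    forall h : history n, play b r s h -> unclaimed h = set0 -> P (avoider_graph h).

(* Main.v *)
(** Let [S] be the sum over the vertices of the sizes of their components in
    Avoider's graph. Avoider claims an unclaimed edge joining two components [C],
    [C'] with [#|C| * #|C'|] minimal. Averaging over the [X] (ordered) crossing
    unclaimed edges, this adds at most [2 S^2 / X] to [S], so [1 / S] drops by at
    most [2 / X], which is at most [4 / u] when [u] edges are unclaimed and [S] is
    small compared to [u]. As [u] decreases by more than [b] in each round, the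
    total drop is at most [4 (ln n^2) / b <= 1 / (25 n)]. Hence [S <= 2 n] all
    along, and since at most [S] unclaimed edges lie inside components, Avoider can
    only run out of crossing edges when at most [2 n <= b] edges are left, that
    is, in the last round. *)
Require Import Defs.
From mathcomp Require Import all_boot all_order all_algebra.
From mathcomp Require Import reals exp.
From mathcomp Require Import zify ring lra.
Import Order.TTheory GRing.Theory Num.Theory.
Local Open Scope ring_scope.

Set Implicit Arguments.
Unset Strict Implicit.
Unset Printing Implicit Defensive.

(** * Connectivity and acyclicity when one edge is added *)

Lemma adj_sym n (F : {set {set 'I_n}}) : symmetric (adj F).
Proof. by move=> x y; rewrite /adj setUC. Qed.

Lemma connect_adj_sym n (F : {set {set 'I_n}}) : connect_sym (adj F).
Proof. exact/sym_connect_sym/adj_sym. Qed.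

Lemma eq_set2 (T : finType) (a b x y : T) :
  [set a; b] = [set x; y] -> (a = x /\ b = y) \/ (a = y /\ b = x).
Proof.
move=> E; have ax : (a == x) || (a == y) by rewrite -in_set2 -E set21.
have bx : (b == x) || (b == y) by rewrite -in_set2 -E set22.
have xa : (x == a) || (x == b) by rewrite -in_set2 E set21.
have ya : (y == a) || (y == b) by rewrite -in_set2 E set22.
case/orP: ax => /eqP ea; case/orP: bx => /eqP eb; case/orP: xa => /eqP ex;
  case/orP: ya => /eqP ey; intuition congruence.
Qed.

Lemma adjU1 n (F : {set {set 'I_n}}) x y a b :
  adj ([set x; y] |: F) a b -> ~~ adj F a b ->
  (a = x /\ b = y) \/ (a = y /\ b = x).
Proof.
by rewrite /adj in_setU1 => /orP[/eqP/eq_set2 //|->].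
Qed.

Lemma connect_adjU1 n (F : {set {set 'I_n}}) x y a b :
  connect (adj ([set x; y] |: F)) a b ->
  [|| connect (adj F) a b,
      connect (adj F) a x && connect (adj F) y b
    | connect (adj F) a y && connect (adj F) x b].
Proof.
case/connectP=> p; elim/last_ind: p b => [|p c IH] b /=.
  by move=> _ ->; rewrite connect0.
rewrite rcons_path last_rcons => /andP[/IH{}IH hc] ->{b}.
move: (IH _ erefl) hc; set d := last a p => had hdc.
have [hF|/(adjU1 hdc)[[ed ec]|[ed ec]]] := boolP (adj F d c).
- have h := connect1 hF.
  by case/or3P: had => [h1|/andP[-> h1]|/andP[-> h1]]; rewrite (connect_trans h1 h) ?orbT.
- rewrite ed in had; rewrite ec connect0 andbT.
  by case/or3P: had => [->|/andP[-> _]|/andP[-> _]]; rewrite ?orbT.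
- rewrite ed in had; rewrite ec connect0 andbT.
  by case/or3P: had => [->|/andP[-> _]|/andP[-> _]]; rewrite ?orbT.
Qed.

(** A cycle through the new edge would leave, once that edge is removed, a path in [F] between [x]
    and [y]. *)
Lemma forestU1 n (F : {set {set 'I_n}}) x y :
  forest F -> [set x; y] \in Kn n -> ~~ connect (adj F) x y ->
  forest ([set x; y] |: F).
Proof.
move=> [FK Fac] eK nxy; split=> [|c /andP[cc uc]].
  by rewrite subUset sub1set eK.
have [/allP hall|/allPn[z zc nz]] := boolP (all (fun z => adj F z (next c z)) c).
  by apply: Fac; rewrite /ucycle uc andbT; apply: cycle_from_next.
have := adjU1 (next_cycle cc zc) nz.
have nxy' : ~~ connect (adj F) y x by rewrite connect_adj_sym.
have [i q Eq] := rot_to zc.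
rewrite -(next_rot i uc) -(size_rot i c) Eq.
move: cc uc; rewrite -(rot_cycle i) -(rot_uniq i) Eq.
case: q {Eq} => [|w [|a q]] //= /and3P[_ hwa hp].
rewrite eqxx !inE !negb_or => /and4P[/and3P[zw za zq] /andP[wa wq] _ _] hzw.
(* The vertices of the cycle are distinct, so every step after the one from [z] to [w] has an end
   outside [[set z; w]] and is an edge of [F]. *)
have keep u v : u != z -> u != w -> adj ([set x; y] |: F) u v -> adj F u v.
  move=> uz uw huv; apply: contraT => /(adjU1 huv).
  by case: hzw uz uw => -[-> ->] /eqP ux /eqP uy [[eu _]|[eu _]].
have keepr u v : adj ([set x; y] |: F) u v -> v != z -> v != w -> adj F u v.
  by rewrite adj_sym (adj_sym F) => huv vz vw; apply: keep huv.
suff : connect (adj F) w z.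
  by case: hzw => -[-> ->] h; rewrite h in nxy nxy'.
apply: (@connect_trans _ _ a).
  by apply/connect1/keepr; rewrite // eq_sym.
apply/connectP; exists (rcons q z); last by rewrite last_rcons.
elim: q a za wa zq wq hp {hwa} => [|c' q IH] a za wa /=.
  by move=> _ _; rewrite !andbT; apply: keep; rewrite eq_sym.
rewrite !inE !negb_or => /andP[zc' zq] /andP[wc' wq] /andP[hac hp].
by rewrite keep 1?eq_sym //=; apply: IH.
Qed.

(** * Component sizes and crossing pairs *)

Definition component_size n (F : {set {set 'I_n}}) (x : 'I_n) : nat :=
  #|connect (adj F) x|.

(** Equivalently the sum of the squared component sizes; random graph theory divides it by [n]. *)
Definition susceptibility n (F : {set {set 'I_n}}) : nat :=
  (\sum_x component_size F x)%N.

(** The pairs are ordered, so each crossing edge counts twice. *)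
Definition crossing n (F U : {set {set 'I_n}}) : {set 'I_n * 'I_n} :=
  [set p | ([set p.1; p.2] \in U) && ~~ connect (adj F) p.1 p.2].

Lemma susceptibilityE n (F : {set {set 'I_n}}) :
  susceptibility F = #|[set p | connect (adj F) p.1 p.2]|.
Proof.
rewrite -sum1_card /susceptibility.
under eq_bigr do rewrite /component_size -sum1_card.
rewrite pair_big_dep /=; apply: eq_bigl => -[x y].
by rewrite !inE.
Qed.

Lemma susceptibility_set0 n : susceptibility (set0 : {set {set 'I_n}}) = n.
Proof.
rewrite /susceptibility -[RHS]card_ord -sum1_card; apply: eq_bigr => x _.
rewrite /component_size -(card1 x); apply: eq_card => y.
rewrite !inE; apply/idP/eqP => [/connectP[[|z p] /=]|->]; first by [].
  by rewrite /adj inE.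
exact: connect0.
Qed.

(** A newly connected ordered pair has one end in the component of [x] and the other in that of
    [y]. *)
Lemma susceptibilityU1 n (F : {set {set 'I_n}}) x y :
  (susceptibility ([set x; y] |: F) <=
   susceptibility F + 2 * (component_size F x * component_size F y))%N.
Proof.
rewrite !susceptibilityE.
set C := fun z => [set u | connect (adj F) z u].
have cardC z : #|C z| = component_size F z by rewrite cardsE.
apply: (@leq_trans #|[set p | connect (adj F) p.1 p.2] :|: (setX (C x) (C y) :|: setX (C y) (C x))|).
  apply/subset_leq_card/subsetP => -[a b]; rewrite !inE /= => /connect_adjU1.
  by rewrite (connect_adj_sym F x a) (connect_adj_sym F y a).
rewrite mul2n -addnn (leq_trans (leq_card_setU _ _)) // leq_add2l.
by rewrite (leq_trans (leq_card_setU _ _)) // !cardsX !cardC [(_ F y * _)%N]mulnC.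
Qed.

Lemma card_Kn_le n : (#|Kn n| <= n ^ 2)%N.
Proof. by rewrite card_draws card_ord bin2; nia. Qed.

(** Each edge of [U] comes from an ordered pair that is crossing or connected in [F], and
    [susceptibility F] counts the connected ones. *)
Lemma card_crossing n (F U : {set {set 'I_n}}) :
  U \subset Kn n -> (#|U| <= #|crossing F U| + susceptibility F)%N.
Proof.
move=> UK; rewrite susceptibilityE.
apply: leq_trans (leq_card_setU _ _).
apply: leq_trans (leq_imset_card (fun p => [set p.1; p.2]) _).
apply/subset_leq_card/subsetP => e eU.
have := subsetP UK e eU; rewrite inE => /cards2P[x [y [_ ee]]].
apply/imsetP; exists (x, y) => //.
by rewrite !inE /= -ee eU orNb.
Qed.

(** * Avoider's strategy and the moves of a round *)

Definition merge_cost n (F : {set {set 'I_n}}) (p : 'I_n * 'I_n) : nat :=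
  (component_size F p.1 * component_size F p.2)%N.

(** Without crossing pairs any unclaimed edge qualifies, which keeps the strategy legal; that edge
    becomes the additional one. *)
Definition good_edge n (F U : {set {set 'I_n}}) (e : {set 'I_n}) : bool :=
  (e \in U) && ((crossing F U == set0) ||
    [exists p in crossing F U, (e == [set p.1; p.2]) &&
      [forall q in crossing F U, merge_cost F p <= merge_cost F q]%N]).

Lemma good_edge_exists n (F U : {set {set 'I_n}}) :
  U != set0 -> exists e, good_edge F U e.
Proof.
case/set0Pn=> e0 e0U.
have [E|/set0Pn[p0 p0X]] := eqVneq (crossing F U) set0.
  by exists e0; rewrite /good_edge e0U E eqxx.
have [p pX pmin] := arg_minnP (merge_cost F) p0X.
have {}pX : p \in crossing F U := pX.
exists [set p.1; p.2]; rewrite /good_edge; apply/andP; split.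
  by move: pX; rewrite inE => /andP[].
apply/orP; right; apply/existsP; exists p; rewrite pX eqxx /=.
by apply/forall_inP.
Qed.

(** The minimum is at most the average, and the sum of [merge_cost] over all ordered pairs factors
    as a square. *)
Lemma merge_cost_le n (F U : {set {set 'I_n}}) p :
  (forall q, q \in crossing F U -> (merge_cost F p <= merge_cost F q)%N) ->
  (merge_cost F p * #|crossing F U| <= susceptibility F ^ 2)%N.
Proof.
move=> pmin; rewrite mulnC -sum_nat_const.
apply: (@leq_trans (\sum_(q in crossing F U) merge_cost F q)%N).
  exact: leq_sum.
apply: (@leq_trans (\sum_q merge_cost F q)%N).
  by rewrite [leqRHS](bigID (mem (crossing F U))) /= leq_addr.
rewrite -mulnn {1}/susceptibility big_distrl /=.
under [leqRHS]eq_bigr do rewrite big_distrr /=.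
by rewrite pair_big.
Qed.

Definition min_merge_strategy n : strategy n := fun h =>
  if [pick e | good_edge (avoider_graph h) (unclaimed h) e] is Some e
  then [set e] else set0.

Lemma min_merge_strategyP n (h : history n) : unclaimed h != set0 ->
  exists2 e, min_merge_strategy h = [set e] &
    good_edge (avoider_graph h) (unclaimed h) e.
Proof.
move=> /(good_edge_exists (avoider_graph h))[e0 ge0]; rewrite /min_merge_strategy.
by case: pickP => [e ge|/(_ e0)]; [exists e | rewrite ge0].
Qed.

Lemma min_merge_legal n b r : legal_strategy b r (@min_merge_strategy n).
Proof.
move=> h _ U0; have [e -> /andP[eU _]] := min_merge_strategyP U0.
have u_gt0 : (0 < #|unclaimed h|)%N by rewrite card_gt0.
rewrite /legal_move sub1set eU cards1.
by case: r; lia.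
Qed.

(** This common consequence of the two rules lets one argument treat both games. *)
Lemma legal_move_ge n r b (U M : {set {set 'I_n}}) :
  legal_move r b U M -> M \subset U /\ (minn b #|U| <= #|M|)%N.
Proof. by rewrite /legal_move; case: r => /andP[-> h]; split=> //; lia. Qed.

Lemma avoider_graph_rcons n (h : history n) A M :
  avoider_graph (rcons h (A, M)) = avoider_graph h :|: A.
Proof. by rewrite /avoider_graph -cats1 big_cat big_seq1. Qed.

Lemma unclaimed_rcons n (h : history n) A M :
  unclaimed (rcons h (A, M)) = (unclaimed h :\: A) :\: M.
Proof.
rewrite /unclaimed avoider_graph_rcons /enforcer_graph -cats1 big_cat big_seq1 /=.
by rewrite !setDDl; congr (_ :\: _); apply/setP => e; rewrite !inE; do !case: (_ \in _).
Qed.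

(** * Bounding the susceptibility along a play *)

Lemma ln_nat_drop (R : realType) (b u v : nat) : (0 < v)%N -> (v + b <= u)%N ->
  b%:R / u%:R <= ln (u%:R : R) - ln (v%:R : R).
Proof.
move=> v0 vbu.
have v0R : 0 < v%:R :> R by rewrite ltr0n.
have u0R : 0 < u%:R :> R by rewrite ltr0n; lia.
have vbuR : v%:R + b%:R <= u%:R :> R by rewrite -natrD ler_nat.
(* This is [ln t <= t - 1] at [t = v / u]. *)
have h : ln (v%:R / u%:R : R) <= v%:R / u%:R - 1.
  have := @le_ln1Dx R (v%:R / u%:R - 1).
  by rewrite addrCA subrr addr0; apply; rewrite ltrBrDr addNr divr_gt0.
rewrite lnM ?posrE ?invr_gt0 // lnV ?posrE // in h.
suff : b%:R / u%:R <= 1 - v%:R / u%:R :> R by lra.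
by rewrite ler_pdivrMr // mulrBl mul1r divfK ?gt_eqF //; lra.
Qed.

(** Rests on [(S + S^2 D) (1/S - D) = 1 - (S D)^2 <= 1]; it makes the losses of [1/S] add up over
    the rounds. *)
Lemma inv_add_sqr_ge (R : realFieldType) (S S' D : R) :
  0 < S -> 0 < S' -> 0 <= D -> S' <= S + S ^+ 2 * D -> S^-1 - D <= S'^-1.
Proof.
move=> S0 S'0 D0 h.
have [hle|hgt] := lerP (S^-1 - D) 0; first by rewrite (le_trans hle) // invr_ge0 ltW.
rewrite -[leLHS]invrK lef_pV2 ?posrE ?invr_gt0 //.
apply: le_trans h _; rewrite -[leRHS]mul1r ler_pdivlMr //.
have -> : (S + S ^+ 2 * D) * (S^-1 - D) = 1 - (S * D) ^+ 2 by field; rewrite gt_eqF.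
by rewrite gerBl sqr_ge0.
Qed.

(** The subtracted term is the loss of [1/S] allowed while the number of unclaimed edges falls from
    at most [n^2] to its present value. The premise keeps [ln] away from 0. *)
Definition susceptibility_controlled (R : realType) n b (h : history n) : Prop :=
  unclaimed h != set0 ->
  n%:R^-1 - 4 * (ln (n%:R ^+ 2) - ln #|unclaimed h|%:R) / b%:R
    <= (susceptibility (avoider_graph h))%:R^-1 :> R.

Lemma susceptibility_ge n (F : {set {set 'I_n}}) : (n <= susceptibility F)%N.
Proof.
rewrite -[leqLHS]card_ord -sum1_card; apply: leq_sum => x _.
by apply/card_gt0P; exists x; apply: connect0.
Qed.

(** From [ln n >= (n - 1) / n]; it turns the bound on [b] into [100 n <= b]. *)
Lemma ln_nat_ge_half (R : realType) n : (1 < n)%N -> 2^-1 <= ln (n%:R : R).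
Proof.
move=> n1; have h : ((1 + (n - 1)) <= n)%N by lia.
have := @ln_nat_drop R _ _ _ (ltn0Sn 0) h; rewrite ln1 subr0; apply: le_trans.
rewrite ler_pdivlMr ?ltr0n 1?ltnW // natrB 1?ltnW //.
have : 2 <= n%:R :> R by rewrite ler_nat.
lra.
Qed.

Lemma susceptibility_controlled_le (R : realType) n b (h : history n) :
  (1 < n)%N -> 200 * n%:R * ln (n%:R : R) <= b%:R ->
  susceptibility_controlled R b h -> unclaimed h != set0 ->
  (susceptibility (avoider_graph h) <= 2 * n)%N.
Proof.
move=> n1 hb hc U0; have := hc U0; set S := susceptibility _; set u := #|_|.
have nR : 0 < n%:R :> R by rewrite ltr0n; lia.
have lnn : 0 < ln (n%:R : R) by rewrite ln_gt0 // ltr1n.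
have SR : 0 < S%:R :> R by rewrite ltr0n (leq_trans _ (susceptibility_ge _)) // ltnW.
have bR : 0 < b%:R :> R by apply: lt_le_trans hb; rewrite !mulr_gt0.
have lnu : 0 <= ln (u%:R : R) by rewrite ln_ge0 // ler1n card_gt0.
rewrite lnXn // -[ln _ *+ 2]mulr_natl => hS.
rewrite -(ler_nat R) natrM -[leLHS]invrK -[leRHS]invrK lef_pV2 ?posrE ?invr_gt0 ?mulr_gt0 //.
apply: le_trans hS; rewrite invfM.
(* Dropping [ln u >= 0] leaves [8 ln n / b], and [b >= 200 n ln n]. *)
have : 4 * (2%:R * ln (n%:R : R) - ln u%:R) / b%:R <= 25^-1 * n%:R^-1.
  rewrite ler_pdivrMr // [leRHS]mulrAC ler_pdivlMr //.
  have : 0 <= ln (u%:R : R) * n%:R by rewrite mulr_ge0 // ltW.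
  lra.
have : 0 < n%:R^-1 :> R by rewrite invr_gt0.
lra.
Qed.

(** One round in numbers: [c] is the cost of the merge, [X] counts the crossing pairs, and primes
    mark values after the round. The loss [4/u] is paid for by the decrease of [ln u]. *)
Lemma susceptibility_controlled_step (R : realType) (n b S S' X c u u' : nat) (L : R) :
  (0 < n)%N -> (100 * n <= b)%N -> (0 < S)%N -> (0 < S')%N ->
  (S <= 2 * n)%N -> (u <= X + S)%N -> (c * X <= S ^ 2)%N ->
  (S' <= S + 2 * c)%N -> (0 < u')%N -> (u' + b <= u)%N ->
  n%:R^-1 - 4 * (L - ln u%:R) / b%:R <= S%:R^-1 :> R ->
  n%:R^-1 - 4 * (L - ln u'%:R) / b%:R <= S'%:R^-1 :> R.
Proof.
move=> n0 nb S0 S'0 Sn uX cX S'c u'0 u'u hS.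
have bR : 0 < b%:R :> R by rewrite ltr0n; lia.
have uR : 0 < u%:R :> R by rewrite ltr0n; lia.
(* Since [S <= 2 n] and [u > 100 n], at least half of [u] is left for [X]. *)
have cu : (c * u <= 2 * S ^ 2)%N.
  apply: (@leq_trans (c * (2 * X))); first by rewrite leq_mul2l; lia.
  by rewrite mulnCA leq_mul2l.
have hS' : S'%:R <= S%:R + S%:R ^+ 2 * (4 / u%:R) :> R.
  apply: (@le_trans _ _ (S%:R + 2 * c%:R)); first by rewrite -natrM -natrD ler_nat.
  rewrite lerD2l mulrA ler_pdivlMr // -mulrA.
  move: cu; rewrite -mulnn -(ler_nat R) !natrM; lra.
have := inv_add_sqr_ge _ _ _ hS'; rewrite !ltr0n divr_ge0 ?ler0n // => /(_ S0 S'0 isT).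
apply: le_trans.
have hl := ln_nat_drop R u'0 u'u.
have hd : 4 / u%:R <= 4 * (ln (u%:R : R) - ln u'%:R) / b%:R.
  rewrite ler_pdivlMr // mulrAC -mulrA ler_pM2l //.
have e : 4 * (L - ln u'%:R) / b%:R =
  4 * (L - ln u%:R) / b%:R + 4 * (ln (u%:R : R) - ln u'%:R) / b%:R by ring.
lra.
Qed.

(** * The invariant over a whole play, and the conclusion *)

Lemma min_merge_play (R : realType) n b r (h : history n) :
  (1 < n)%N -> 200 * n%:R * ln (n%:R : R) <= b%:R ->
  play b r (@min_merge_strategy n) h ->
  (forest (avoider_graph h) /\ susceptibility_controlled R b h) \/
  (unclaimed h = set0 /\ forest_plus_at_most_one_edge (avoider_graph h)).
Proof.
move=> n1 hb.
have nb : (100 * n <= b)%N.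
  rewrite -(ler_nat R); apply: le_trans hb; rewrite natrM.
  have := ln_nat_ge_half R n1; rewrite -(ler_pM2l (_ : 0 < n%:R :> R)) ?ltr0n 1?ltnW //.
  lra.
elim=> [|{}h M _ IH U0 /legal_move_ge[MU Mb]]; [left; split|].
- rewrite /avoider_graph big_nil; split=> [|[|x [|y c]] //]; first exact: sub0set.
  by rewrite /ucycle /= {1}/adj inE.
- move=> U0; rewrite /avoider_graph big_nil susceptibility_set0 gerBl.
  rewrite divr_ge0 ?ler0n // mulr_ge0 // subr_ge0 ler_ln ?posrE ?ltr0n ?card_gt0 //.
    rewrite -natrX ler_nat (leq_trans (subset_leq_card (subsetDl _ _))) ?card_Kn_le //.
  by rewrite exprn_gt0 // ltr0n ltnW.
case: IH => [[Fh Sh]|[E]]; last by rewrite E eqxx in U0.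
have [e se /andP[eU ge]] := min_merge_strategyP U0.
rewrite se in MU Mb *; rewrite /susceptibility_controlled unclaimed_rcons avoider_graph_rcons setUC.
set U := unclaimed h in U0 MU Mb eU ge *; set F := avoider_graph h in Fh Sh ge *.
have UK : U \subset Kn n := subsetDl _ _.
have S2 := susceptibility_controlled_le n1 hb Sh U0.
have uX := card_crossing F UK.
have cU : #|U| = #|U :\ e|.+1 by rewrite (cardsD1 e) eU.
have cM : (#|U :\ e :\: M| + #|M| = #|U :\ e|)%N.
  by rewrite cardsDS // subnK // subset_leq_card.
case/orP: ge => [/eqP X0|/existsP[p /and3P[pX /eqP ee /forall_inP pmin]]].
  (* With no crossing pair at most [2 n <= b] edges are unclaimed, so Enforcer must take all that
     [e] leaves. *)
  right; split.
    by apply/eqP; rewrite -cards_eq0; rewrite X0 cards0 in uX; rewrite -/F in S2; lia.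
  exists F, [set e]; split=> //; last by rewrite setUC.
    by rewrite sub1set (subsetP UK).
  by rewrite cards1.
left; split.
  rewrite ee; apply: forestU1 => //.
    by rewrite -ee (subsetP UK).
  by move: pX; rewrite inE => /andP[].
(* Some edge survives Enforcer's move, so [M] has at least [b] edges. *)
rewrite -card_gt0 => u'0.
apply: (@susceptibility_controlled_step R n b (susceptibility F) _ #|crossing F U| (merge_cost F p) #|U|) => //.
- exact: ltnW.
- exact: leq_trans (ltnW n1) (susceptibility_ge _).
- exact: leq_trans (ltnW n1) (susceptibility_ge _).
- exact: merge_cost_le.
- by rewrite ee susceptibilityU1.
- lia.
- exact: Sh.
Qed.

Theorem theorem1p1 (R : realType) :
  exists n0 : nat, forall n : nat, (n0 <= n)%N ->
    forall b : nat, 200 * n%:R * ln (n%:R : R) <= b%:R ->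
      avoider_can_ensure b Monotone (@forest_plus_at_most_one_edge n) /\
      avoider_can_ensure b Strict (@forest_plus_at_most_one_edge n).
Proof.
exists 2%N => n n1 b hb.
have main r : avoider_can_ensure b r (@forest_plus_at_most_one_edge n).
  exists (@min_merge_strategy n); first exact: min_merge_legal.
  move=> h /(min_merge_play n1 hb)[[Fh _] _|[]//].
  exists (avoider_graph h), set0; split=> //; rewrite ?sub0set ?cards0 //.
  by rewrite setU0.
by split; apply: main.
Qed.
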